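(* Let $d\ge 3$, let $\mathbf{K}\subset\mathbb{E}^d$ be a convex body, and let $r$ be a positive real number with the property that the Gauss image $\nu(F)$ of any face $F$ of $\mathbf{K}$ can be covered by a $(d-1)$-dimensional closed spherical ball of (angular) radius $r$ in $\mathbb{S}^{d-1}$. Moreover, assume that there exist $k$ points of $\mathbb{S}^{d-1}$ with covering radius $R$ satisfying the inequality $r+R\le\frac{\pi}{2}$. Then $I(\mathbf{K})\le k$.
   Context: $\mathbb{E}^d$ is $d$-dimensional Euclidean space and $\mathbb{S}^{d-1}\subset\mathbb{E}^d$ is the unit sphere centered at the origin. A convex body is a compact convex set with nonempty interior. Illumination number: a direction $\mathbf{v}\in\mathbb{S}^{d-1}$ illuminates a boundary point $\mathbf{b}$ of a convex body $\mathbf{K}$ if the halfline emanating from $\mathbf{b}$ with direction vector $\mathbf{v}$ intersects the interior of $\mathbf{K}$. Directions $\mathbf{v}_1,\dots,\mathbf{v}_n$ illuminate $\mathbf{K}$ if each boundary point of $\mathbf{K}$ is illuminated by at least one of them. $I(\mathbf{K})$ is the smallest $n$ for which there exist $n$ directions that illuminate $\mathbf{K}$. A face of $\mathbf{K}$ is the intersection of a supporting hyperplane of $\mathbf{K}$ with the boundary of $\mathbf{K}$. The Gauss image $\nu(F)$ of a face $F$ is the set of all $\mathbf{u}\in\mathbb{S}^{d-1}$ such that the supporting hyperplane of $\mathbf{K}$ with outer normal vector $\mathbf{u}$ contains $F$. The covering radius of a finite set $Y\subset\mathbb{S}^{d-1}$ is the smallest positive real number $R$ such that the $(d-1)$-dimensional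 closed spherical balls of angular radius $R$ centered at the points of $Y$ cover $\mathbb{S}^{d-1}$. *)

(* Defs.v *)
From HB Require Import structures.
From mathcomp Require Import all_boot all_order all_algebra.
From mathcomp Require Import all_classical all_reals all_analysis.
Import Order.TTheory GRing.Theory Num.Theory.
Import numFieldNormedType.Exports.

Set Implicit Arguments.
Unset Strict Implicit.
Unset Printing Implicit Defensive.

Local Open Scope classical_set_scope.
Local Open Scope ring_scope.

(* E^d is 'rV[R]_d. Its library topology is the product topology, hence the
   Euclidean one, but its library norm `|x| is the sup norm; lengths and angles
   are therefore expressed through the inner product below. *)
Section Euclidean.
Context {R : realType} {d : nat}.
Implicit Types (u v b c x y : 'rV[R]_d) (K F H Y : set 'rV[R]_d).

Definition dot u v : R := \sum_(i < d) u ord0 i * v ord0 i.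

Definition unit_sphere : set 'rV[R]_d := [set u | dot u u = 1].

Definition angular_dist u v : R := acos (dot u v).

Definition spherical_ball c (rho : R) : set 'rV[R]_d :=
  [set u | unit_sphere u /\ angular_dist c u <= rho].

Definition boundary K : set 'rV[R]_d := closure K `\` K°.

Definition convex_body K : Prop :=
  [/\ compact K,
      convex_set (K : set (convex_lmodType 'rV[R]_d)) &
      K° !=set0].

Definition halfline b v : set 'rV[R]_d := [set b + t *: v | t in [set t | 0 <= t]].

Definition illuminates K v b : Prop := halfline b v `&` K° !=set0.

Definition illuminated_by K (n : nat) : Prop :=
  exists v : 'I_n -> 'rV[R]_d,
    (forall i, unit_sphere (v i)) /\
    (forall b, boundary K b -> exists i, illuminates K (v i) b).

(* A relation and not a function to nat, so that no junk value is assigned to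
   a body that finitely many directions fail to illuminate. *)
Definition is_illumination_number K (n : nat) : Prop :=
  illuminated_by K n /\ (forall m : nat, illuminated_by K m -> (n <= m)%N).

Definition hyperplane u (a : R) : set 'rV[R]_d := [set x | dot u x = a].

(* H is the supporting hyperplane of K with outer unit normal u. *)
Definition supporting_hyperplane K u H : Prop :=
  unit_sphere u /\
  exists a : R, [/\ H = hyperplane u a,
                    K `<=` [set x | dot u x <= a] &
                    H `&` K !=set0].

Definition face K F : Prop :=
  exists u H, supporting_hyperplane K u H /\ F = H `&` boundary K.

Definition gauss_image K F : set 'rV[R]_d :=
  [set u | exists2 H, supporting_hyperplane K u H & F `<=` H].

Definition covers_sphere Y (rho : R) : Prop :=
  unit_sphere `<=` \bigcup_(y in Y) spherical_ball y rho.

Definition is_covering_radius Y (rho : R) : Prop :=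
  [/\ 0 < rho, covers_sphere Y rho &
      forall rho' : R, 0 < rho' -> covers_sphere Y rho' -> rho <= rho'].

End Euclidean.

(* Main.v *)
Require Import Defs.
From HB Require Import structures.
From mathcomp Require Import all_boot all_order all_algebra.
From mathcomp Require Import all_classical all_reals all_analysis.
From mathcomp Require Import ring lra.
Import Order.TTheory GRing.Theory Num.Theory.
Import numFieldNormedType.Exports.

Local Open Scope classical_set_scope.
Local Open Scope ring_scope.
Local Open Scope card_scope.

(* If no direction of Y illuminates a boundary point b, let c be the center of a
   cap of radius r containing the normals at b. Some y in Y lies within rho of
   - c; since r + rho <= pi / 2 every normal u at b satisfies <u, y> <= 0, and
   equality <u, y> = 0 forces <c, y> = - cos rho and u proportional to
   c + (cos rho) y. This borderline case is dealt with as follows.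
   - If the normals at b lie in a hyperplane orthogonal to w, all the borderline y
     make the same inner product with the component of w orthogonal to c, so
     that moving c along this component or its opposite gives a unit vector
     whose antipode is not covered by the caps of radius rho.
   - If the normals at b span the space, b is the only maximizer over K of a
     rational linear form, so there are countably many such b. By Baire's
     theorem, Y may be replaced by its image under a reflection such that
     <c, y> <> - cos rho for all the corresponding centers c.
   The normals at b are the Gauss image of the smallest exposed face through b, and
   a ray from b missing the interior of K has direction v with <u, v> >= 0 for
   some normal u at b. *)

(** * Inner product, unit vectors and reflections *)

Section Dot.
Context {R : realType} {d : nat}.
Implicit Types (u v w x y z c : 'rV[R]_d) (a : R).

Lemma dotC u v : dot u v = dot v u.
Proof. by apply: eq_bigr => i _; rewrite mulrC. Qed.

Lemma dotDl u v w : dot (u + v) w = dot u w + dot v w.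
Proof. by rewrite -big_split; apply: eq_bigr => i _; rewrite mxE mulrDl. Qed.

Lemma dotZl a u v : dot (a *: u) v = a * dot u v.
Proof. by rewrite [RHS]mulr_sumr; apply: eq_bigr => i _; rewrite mxE mulrA. Qed.

Lemma dotNl u v : dot (- u) v = - dot u v.
Proof. by rewrite -scaleN1r dotZl mulN1r. Qed.

Lemma dotDr u v w : dot u (v + w) = dot u v + dot u w.
Proof. by rewrite !(dotC u) dotDl. Qed.

Lemma dotZr a u v : dot u (a *: v) = a * dot u v.
Proof. by rewrite !(dotC u) dotZl. Qed.

Lemma dotNr u v : dot u (- v) = - dot u v.
Proof. by rewrite !(dotC u) dotNl. Qed.

Definition dotE := (dotDl, dotDr, dotNl, dotNr, dotZl, dotZr).

Lemma dot0l u : dot 0 u = 0.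
Proof. by rewrite -(scale0r 0) dotZl mul0r. Qed.

Lemma dot0r u : dot u 0 = 0.
Proof. by rewrite dotC dot0l. Qed.

Lemma dot_ge0 u : 0 <= dot u u.
Proof. by apply: sumr_ge0 => i _; rewrite -expr2 sqr_ge0. Qed.

Lemma dot_eq0 u : (dot u u == 0) = (u == 0).
Proof.
apply/idP/eqP => [|->]; last by rewrite dot0l.
rewrite psumr_eq0 => [/allP h|i _]; last by rewrite -expr2 sqr_ge0.
apply/rowP => i; have := h i (mem_index_enum _).
by rewrite mxE -expr2 sqrf_eq0 => /eqP.
Qed.

Lemma dot_gt0 u : (0 < dot u u) = (u != 0).
Proof. by rewrite lt_def dot_ge0 andbT dot_eq0. Qed.

Lemma dot_mulmx u v : dot u v = (u *m v^T) ord0 ord0.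
Proof. by rewrite mxE; apply: eq_bigr => i _; rewrite mxE. Qed.

Definition normalize u := (Num.sqrt (dot u u))^-1 *: u.

Lemma sqrt_dot_gt0 u : u != 0 -> 0 < Num.sqrt (dot u u).
Proof. by move=> u0; rewrite sqrtr_gt0 dot_gt0. Qed.

Lemma unit_normalize u : u != 0 -> unit_sphere (normalize u).
Proof.
move=> u0; rewrite /unit_sphere /= !dotE.
have := sqrt_dot_gt0 u u0; have := sqr_sqrtr (dot_ge0 u).
move: (Num.sqrt _) => e <- e0.
by field; rewrite gt_eqF.
Qed.

Lemma unit_neq0 u : unit_sphere u -> u != 0.
Proof. by move=> u1; rewrite -dot_gt0 u1. Qed.

Lemma unit_dot_le1 u v : unit_sphere u -> unit_sphere v -> -1 <= dot u v <= 1.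
Proof.
rewrite /unit_sphere /= => u1 v1.
have := dot_ge0 (u - v); have := dot_ge0 (u + v).
rewrite !dotE (dotC v u) u1 v1 => ? ?; apply/andP; split; lra.
Qed.

(* The identity if [v = 0], since then [dot v v] and its inverse are 0. *)
Definition reflection v x := x - (2 * dot v x / dot v v) *: v.

(** Self-adjointness; with [reflectK] it makes [reflection v] an isometry, which carries coverings
    by caps to coverings by caps. *)
Lemma reflect_dot v x y : dot (reflection v x) y = dot x (reflection v y).
Proof. by rewrite /reflection !dotE (dotC x v); ring. Qed.

Lemma reflectK v : involutive (reflection v).
Proof.
move=> x; have [->|v0] := eqVneq v 0.
  by rewrite /reflection !scaler0 !subr0.
rewrite /reflection -addrA -opprD -scalerDl !dotE.
rewrite (_ : 2 * dot v x / dot v v + _ = 0) ?scale0r ?subr0//.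
by field; rewrite gt_eqF// dot_gt0.
Qed.

Lemma unit_reflect v x : unit_sphere x -> unit_sphere (reflection v x).
Proof. by rewrite /unit_sphere /= reflect_dot reflectK. Qed.

End Dot.

(** * Coverings by caps; [s] and [kappa] are the sine and cosine of the cap radius *)

Section Illuminating_direction.
Context {R : realType} {d : nat}.
Implicit Types (u v w x y z c : 'rV[R]_d) (N : set 'rV[R]_d).
Context (s kappa : R) (s_gt0 : 0 < s) (kappa_gt0 : 0 < kappa)
  (sk : s ^+ 2 + kappa ^+ 2 = 1).

(* The hypotheses force [e := s u - c - kappa y] to satisfy [|e|^2 <= 0]. *)
Lemma opposite_caps u c y :
  unit_sphere u -> unit_sphere c -> unit_sphere y ->
  s <= dot u c -> dot c y <= - kappa -> 0 <= dot u y ->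
  dot c y = - kappa /\ s *: u = c + kappa *: y.
Proof.
rewrite /unit_sphere /= => u1 c1 y1 hu hc hy.
pose e := s *: u - (c + kappa *: y).
have eE : dot e e = 2 - 2 * s * dot u c - 2 * (s * kappa * dot u y) + 2 * kappa * dot c y.
  rewrite !dotE (dotC c u) (dotC y u) (dotC y c) u1 c1 y1.
  transitivity (s ^+ 2 + kappa ^+ 2 + 1 - 2 * s * dot u c
                - 2 * (s * kappa * dot u y) + 2 * kappa * dot c y).
    by ring.
  by rewrite sk; ring.
have e0 := dot_ge0 e.
have h1 : s * s <= s * dot u c by rewrite ler_pM2l.
have h2 : kappa * dot c y <= kappa * - kappa by rewrite ler_pM2l.
have h3 : 0 <= s * kappa * dot u y by rewrite !mulr_ge0// ltW.
have sk' : s * s + kappa * kappa = 1 by rewrite -!expr2.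
split.
  apply/eqP; rewrite -(inj_eq (mulfI (lt0r_neq0 kappa_gt0))); apply/eqP.
  move: eE e0 h1 h2 h3 sk'.
  lra.
apply/eqP; rewrite -subr_eq0 -/e -dot_eq0; apply/eqP.
move: eE e0 h1 h2 h3 sk'; lra.
Qed.

Context (k : nat) (y : 'I_k -> 'rV[R]_d) (y1 : forall i, unit_sphere (y i))
  (y_cover : forall z, unit_sphere z -> exists i, kappa <= dot z (y i)).

(* Otherwise moving [c] along [g] gives a unit vector whose antipode no cap covers. *)
Lemma no_common_ascent c g : unit_sphere c -> g != 0 -> dot c g = 0 ->
  (forall i, - kappa <= dot c (y i)) ->
  exists i, dot c (y i) = - kappa /\ dot g (y i) < 0.
Proof.
move=> c1 g0 cg hc; apply: contrapT => /forallNP h.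
(* A tight constraint does not decrease along [g]; a slack one survives while [t * |dot g (y i)|] is
   at most the slack. *)
have hi i : exists2 t, 0 < t & forall t', 0 < t' <= t ->
    - kappa <= dot (c + t' *: g) (y i).
  have [e|ne] := eqVneq (dot c (y i)) (- kappa).
    have : 0 <= dot g (y i) by rewrite leNgt; apply/negP => gy; apply: (h i).
    move=> gy; exists 1 => // t /andP[t0 _]; rewrite !dotE e lerDl.
    by rewrite mulr_ge0// ltW.
  have lt : 0 < dot c (y i) + kappa.
    by rewrite -ltrBlDr sub0r lt_def hc ne.
  have p0 : 0 < `|dot g (y i)| + 1 by rewrite ltr_wpDl.
  exists ((dot c (y i) + kappa) / (`|dot g (y i)| + 1)); first exact: divr_gt0.
  move=> t /andP[t0]; rewrite ler_pdivlMr// => le; rewrite !dotE.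
  have : t * - dot g (y i) <= t * (`|dot g (y i)| + 1).
    by rewrite ler_pM2l// -(normrN (dot g (y i))) ler_wpDr// ler_norm.
  move: le; rewrite mulrN; lra.
have [t t0 ht] : exists2 t, 0 < t & forall i, - kappa <= dot (c + t *: g) (y i).
  have /choice[f fP] i : exists t, 0 < t /\ forall t', 0 < t' <= t ->
      - kappa <= dot (c + t' *: g) (y i).
    by have [t ? ?] := hi i; exists t.
  have m0 : 0 < \big[Num.min/1]_i f i.
    by elim/big_ind : _ => // [a b a0 b0|i _]; [rewrite lt_min a0|case: (fP i)].
  exists (\big[Num.min/1]_i f i) => // i; have [_] := fP i; apply.
  by rewrite m0; exact: bigmin_le_cond.
(* As [g] is orthogonal to [c], [z] is longer than 1, so a cap containing the direction of [- z]
   would force [dot z (y i) < - kappa]. *)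
pose z := c + t *: g.
have zz : 1 < dot z z.
  rewrite /z !dotE (dotC g c) cg c1.
  have : 0 < t * (t * dot g g) by rewrite !mulr_gt0// dot_gt0.
  lra.
have {}ht i : - kappa <= dot z (y i) by exact: ht.
move: z zz ht => z zz ht.
have z0 : - z != 0 by rewrite oppr_eq0 -dot_gt0 (lt_trans _ zz).
have [i] := y_cover _ (unit_normalize _ z0).
rewrite /normalize !(dotNl, dotNr, dotZl) opprK => le.
have q1 : 1 < Num.sqrt (dot z z) by rewrite -sqrtr1 ltr_sqrt// (lt_trans _ zz).
have q0 : 0 < Num.sqrt (dot z z) by rewrite (lt_trans _ q1).
move: le; rewrite mulrC ler_pdivlMr// => le; have ge := ht i.
have : kappa < kappa * Num.sqrt (dot z z) by rewrite ltr_pMr.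
lra.
Qed.

(** If every [y i] fails, [opposite_caps] turns the center of a cap around [- c] into an equality
    case. The first alternative forbids this; the second is refuted by [no_common_ascent]. *)
Lemma direction_below c N : unit_sphere c ->
  (forall u, N u -> unit_sphere u /\ s <= dot u c) ->
  (forall i, dot c (y i) != - kappa) \/
    (exists2 w, w != 0 & forall u, N u -> dot u w = 0) ->
  exists i, forall u, N u -> dot u (y i) < 0.
Proof.
move=> c1 hN hNw; apply: contrapT => /forallNP h.
have hu i : exists u, N u /\ 0 <= dot u (y i).
  apply: contrapT => /forallNP hi; apply: (h i) => u Nu.
  by rewrite ltNge; apply/negP => ge; exact: (hi u).
have touch i : dot c (y i) <= - kappa ->
    dot c (y i) = - kappa /\ exists2 u, N u & s *: u = c + kappa *: y i.
  move=> le; have [u [Nu ge]] := hu i; have [u1 hs] := hN u Nu.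
  by have [? ?] := opposite_caps _ _ _ u1 c1 (y1 i) hs le ge; split=> //; exists u.
have [i0 i0P] : exists i, dot c (y i) <= - kappa.
  have [|i] := y_cover (- c); first by rewrite /unit_sphere /= !dotE opprK.
  by rewrite dotNl => le; exists i; rewrite lerNr.
have [e0 [u0 Nu0 u0E]] := touch _ i0P.
case: hNw => [/(_ i0)/eqP//|[w w0 wN]].
have hc i : - kappa <= dot c (y i).
  rewrite leNgt; apply/negP => lt; have [e] := touch i (ltW lt).
  by move: lt; rewrite e ltxx.
pose g := w - dot w c *: c.
have cg : dot c g = 0 by rewrite /g !dotE c1 (dotC w c); ring.
have kn := lt0r_neq0 kappa_gt0.
(* The product of [s u = c + kappa y i] with [w] vanishes, which determines [dot w (y i)], the same
   for all borderline [i]. *)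
have gy i : dot c (y i) = - kappa -> kappa * dot g (y i) = dot w c * (kappa ^+ 2 - 1).
  move=> e; have [|_ [u Nu uE]] := touch i; first by rewrite e.
  have : dot (s *: u) w = 0 by rewrite dotZl wN// mulr0.
  rewrite uE !dotE (dotC c) (dotC (y i)) => hw.
  rewrite mulrDr mulrN mulrA (mulrC kappa (dot w c)) e.
  by rewrite (_ : kappa * dot w (y i) = - dot w c); [ring|lra].
have k1 : kappa ^+ 2 - 1 < 0 by rewrite -sk; have := exprn_gt0 2 s_gt0; lra.
have [g0|g0] := eqVneq g 0.
  have := gy _ e0; rewrite g0 dot0l mulr0 => /esym/eqP.
  rewrite mulf_eq0 (lt_eqF k1) orbF => /eqP wc.
  by move: g0; rewrite /g wc scale0r subr0 => /eqP; rewrite (negbTE w0).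
(* By [gy], one of [g] and [- g] has a nonnegative product with all borderline [y i]. *)
have [wc|wc] := lerP (dot w c) 0.
  have [i [e lt]] := no_common_ascent c g c1 g0 cg hc.
  have := gy i e.
  have : kappa * dot g (y i) < 0 by rewrite pmulr_rlt0.
  have : 0 <= dot w c * (kappa ^+ 2 - 1) by rewrite mulr_le0// ltW.
  lra.
have [||i [e]] := no_common_ascent c (- g) c1 _ _ hc.
- by rewrite oppr_eq0.
- by rewrite dotNr cg oppr0.
rewrite dotNl oppr_lt0 => lt; have := gy i e.
have : 0 < kappa * dot g (y i) by rewrite pmulr_rgt0.
have : dot w c * (kappa ^+ 2 - 1) < 0 by rewrite pmulr_rlt0.
lra.
Qed.

End Illuminating_direction.

(** * Separating hyperplanes and existence of normals *)

Section Separation.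
Context {R : realType} {d : nat}.
Implicit Types (u v b x y z p : 'rV[R]_d) (K : set 'rV[R]_d) (t : R).

Lemma continuous_dot (T : topologicalType) (f g : T -> 'rV[R]_d) :
  continuous f -> continuous g -> continuous (fun a => dot (f a) (g a) : R).
Proof.
move=> cf cg; apply: continuous_big => [|i _]; first exact: add_continuous.
by move=> a; apply: cvgM; [move: (cf a)|move: (cg a)] => h;
  apply: (cvg_comp _ (fun M : 'rV[R]_d => M ord0 i) h); exact: coord_continuous.
Qed.

Lemma continuous_subr p : continuous (fun x => x - p).
Proof.
by move=> x; exact: (@cvgB _ _ _ (nbhs x) _ id (fun=> p) _ _ cvg_id (cvg_cst _)).
Qed.

Lemma compact_unit_sphere : compact (unit_sphere : set 'rV[R]_d).
Proof.
pose B := [set v : 'rV[R]_d | forall i, `[-1, 1]%classic (v ord0 i)].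
apply: (@subclosed_compact _ _ B).
- apply: (continuous_closedP (fun u : 'rV[R]_d => dot u u : R)).1 [set 1] _.
    by apply: continuous_dot => a; exact: cvg_id.
  exact: closed_eq.
- by apply: (@rV_compact R d (fun=> `[(-1 : R), 1]%classic)) => i; exact: segment_compact.
- move=> u u1 i /=; rewrite in_itv /=.
  have : (u ord0 i) ^+ 2 <= 1.
    rewrite -u1 /dot (bigD1 i) //= -expr2 lerDl; apply: sumr_ge0 => j _.
    by rewrite -expr2 sqr_ge0.
  by move=> h; rewrite -ler_norml -(@expr_le1 _ 2) // real_normK ?num_real.
Qed.

Lemma convex_comb K x y t : convex_set (K : set (convex_lmodType 'rV[R]_d)) ->
  K x -> K y -> 0 <= t <= 1 -> K (t *: x + (1 - t) *: y).
Proof.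
move=> cK Kx Ky /andP[t0 t1].
by have := cK x y (Itv01 t0 t1) (mem_set Kx) (mem_set Ky); rewrite inE.
Qed.

(** [f] inverts the homothety of ratio [t] centered at [x], so the preimage of [K] under [f] is a
    neighborhood of the point and lies in [K]. *)
Lemma convex_interior K x z t : convex_set (K : set (convex_lmodType 'rV[R]_d)) ->
  K x -> K° z -> 0 < t <= 1 -> K° (t *: z + (1 - t) *: x).
Proof.
move=> cK Kx Kz /andP[t0 t1].
pose f := fun y : 'rV[R]_d => t^-1 *: (y - (1 - t) *: x).
have cf : continuous f.
  by move=> y; exact: (cvgZl_tmp (continuous_subr _ y)).
have nK : nbhs (f (t *: z + (1 - t) *: x)) K.
  by rewrite /f addrK scalerA mulVf ?gt_eqF// scale1r.
have {nK} nK := cf _ _ nK; change (nbhs (t *: z + (1 - t) *: x) K).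
apply: (@filterS _ _ (nbhs_filter _) _ _ _ nK) => y /= Ky.
rewrite (_ : y = t *: f y + (1 - t) *: x).
  by apply: (convex_comb K _ _ t cK) => //; rewrite ltW.
by rewrite /f scalerA mulfV ?gt_eqF// scale1r subrK.
Qed.

(** The normal points from the nearest point [x0] of [K] towards [p]. *)
Lemma strict_separation K p : compact K ->
  convex_set (K : set (convex_lmodType 'rV[R]_d)) -> K !=set0 -> ~ K p ->
  exists2 u, unit_sphere u & forall x, K x -> dot u x <= dot u p.
Proof.
move=> kK cK K0 Kp.
have cd : continuous (fun x : 'rV[R]_d => dot (x - p) (x - p) : R).
  by apply: continuous_dot; exact: continuous_subr.
have [x0] := EVT_min_rV K0 kK (continuous_subspaceT cd).
rewrite inE => Kx0 x0min.
have px0 : p - x0 != 0.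
  by rewrite subr_eq0; apply: contra_notN Kp => /eqP ->.
exists (normalize (p - x0)); first exact: unit_normalize.
move=> x Kx; rewrite !dotZl ler_pM2l ?invr_gt0 ?sqrt_dot_gt0//.
suff h : dot (p - x0) (x - x0) <= 0.
  have := dot_ge0 (p - x0); move: h; rewrite !dotE; lra.
rewrite leNgt; apply/negP => h.
have key t : 0 < t -> t <= 1 -> 2 * dot (p - x0) (x - x0) <= t * dot (x - x0) (x - x0).
  move=> t0 t1; have Kt : K (t *: x + (1 - t) *: x0).
    by apply: (convex_comb K _ _ t cK) => //; rewrite ltW.
  have := x0min _ (mem_set Kt).
  have -> : t *: x + (1 - t) *: x0 - p = t *: (x - x0) - (p - x0).
    by apply/rowP => i; rewrite !mxE; ring.
  have -> : dot (x0 - p) (x0 - p) = dot (p - x0) (p - x0).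
    by rewrite -(opprB p x0) dotNl dotNr opprK.
  move: (p - x0) (x - x0) => a e.
  rewrite !dotE (dotC e a) => le.
  have : t * (2 * dot a e) <= t * (t * dot e e) by lra.
  by rewrite ler_pM2l.
set m := dot (p - x0) (x - x0) in h key; set q := dot (x - x0) (x - x0) in key.
have q0 : 0 <= q by exact: dot_ge0.
(* Take [t = 1], or [t = m / q] when this is below 1; either way [key] gives [2 m <= m]. *)
have [m1|m1] := lerP q m.
  by have := key 1 ltr01 (lexx _); lra.
have qq : 0 < q by rewrite (lt_trans h).
have := key (m / q) (divr_gt0 h qq); rewrite ler_pdivrMr// mul1r => /(_ (ltW m1)).
rewrite divfK ?gt_eqF//; lra.
Qed.

(** The length of [u] is left free, so that these vectors form the normal cone at [b] and may be
    added. *)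
Definition normal_at K b u := forall x, K x -> dot u x <= dot u b.

(* For [z] interior and [e > 0] the ray from [b] in direction [v - e (z - b)]
   leaves [K] at [b]; [u] is a cluster point, as [e] tends to 0, of unit normals
   of hyperplanes separating [K] from [b + e (v - e (z - b))]. *)
Lemma normal_of_missed_ray K b v : convex_body K -> K b ->
  (forall t, 0 <= t -> ~ K° (b + t *: v)) ->
  exists u, [/\ unit_sphere u, normal_at K b u & 0 <= dot u v].
Proof.
move=> [kK cK [z Kz]] Kb hv.
have out e : 0 < e -> ~ K (b + e *: (v - e *: (z - b))).
  (* [b + (e / l) v] combines [z] and the tilted point with weights [e^2 / l] and [1 / l], so it
     would be interior. *)
  move=> e0 Ke; pose l := 1 + e ^+ 2.
  have l0 : 1 < l by rewrite ltrDl exprn_gt0.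
  have ln : l != 0 by rewrite gt_eqF// (lt_trans _ l0).
  apply: (hv (e / l)); first by rewrite divr_ge0 ?ltW// (lt_trans _ l0).
  rewrite (_ : b + _ = (e ^+ 2 / l) *: z +
      (1 - e ^+ 2 / l) *: (b + e *: (v - e *: (z - b)))).
    apply: convex_interior => //.
    rewrite divr_gt0 ?exprn_gt0 ?(lt_trans _ l0)//=.
    by rewrite ler_pdivrMr ?(lt_trans _ l0)// mul1r lerDr.
  apply/rowP => i; rewrite !mxE /l; field.
  by rewrite -/l.
pose e (n : nat) : R := n.+1%:R^-1.
have e0 n : 0 < e n by rewrite invr_gt0 ltr0n.
have /choice[u uP] n : exists u, unit_sphere u /\ forall x, K x ->
    dot u x <= dot u (b + e n *: (v - e n *: (z - b))).
  have [|u ? ?] := strict_separation _ _ kK cK _ (out (e n) (e0 n)); last by exists u.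
  by exists b.
have [w [w1 wcl]] := compact_unit_sphere (u @ \oo) _
  (filterS (fun n _ => proj1 (uP n)) filterT).
(* A closed half-space that eventually contains the [u n] contains their cluster point [w]; [del]
   absorbs the errors. *)
have lim (a : 'rV[R]_d) (c : R) :
    (forall del, 0 < del -> \forall n \near \oo, dot (u n) a <= c + del) -> dot w a <= c.
  move=> h; apply/ler_addgt0Pr => del del0.
  suff : closure [set x : 'rV[R]_d | dot x a <= c + del] w.
    rewrite -(closure_id _).1//.
    apply: (continuous_closedP (fun u : 'rV[R]_d => dot u a : R)).1
      [set x : R | x <= c + del] _.
      by apply: continuous_dot => q; [exact: cvg_id|exact: (@cvg_cst _ a _ (nbhs q) _)].
    exact: closed_le.
  by move: wcl; rewrite clusterE; apply; exact: (h _ del0).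
have dot_bound n a : dot (u n) a <= 1 + dot a a.
  have := dot_ge0 (u n - a); have := dot_ge0 a; have [u1 _] := uP n.
  by rewrite !dotE (dotC a) u1; lra.
(* The sum of the bounds on [dot (u n) v] and [dot (u n) (b - z)]. *)
pose M : R := 2 + dot v v + dot (b - z) (b - z).
have M0 : 0 < M by rewrite /M; have := dot_ge0 v; have := dot_ge0 (b - z); lra.
have eM del : 0 < del -> \forall n \near \oo, e n * M <= del.
  move=> del0; have := near_infty_natSinv_lt (PosNum (divr_gt0 del0 M0)).
  by apply: filterS => n /= /ltW; rewrite ler_pdivlMr.
have uv n : dot (u n) v <= 1 + dot v v by exact: dot_bound.
have ubz n : dot (u n) (b - z) <= 1 + dot (b - z) (b - z) by exact: dot_bound.
have e1 n : e n <= 1 by rewrite invf_le1 ?ltr0n// ler1n.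
have step n x : K x -> dot (u n) (x - b) <= e n * (dot (u n) v + e n * dot (u n) (b - z)).
  move=> /(proj2 (uP n) x); rewrite !dotE => h; lra.
exists w; split=> //.
- move=> x Kx; rewrite -subr_le0 -dotNr -dotDr; apply: lim => del del0.
  apply: filterS (eM _ del0) => n; rewrite add0r; apply: le_trans.
  apply: (le_trans (step n x Kx)); rewrite ler_pM2l ?e0//.
  have : e n * dot (u n) (b - z) <= e n * (1 + dot (b - z) (b - z)) by rewrite ler_pM2l.
  have : e n * (1 + dot (b - z) (b - z)) <= 1 * (1 + dot (b - z) (b - z)).
    by rewrite ler_wpM2r// addr_ge0// dot_ge0.
  rewrite /M; have := uv n; lra.
(* Taking [x = b] in [step] and dividing by [e n] bounds [- dot (u n) v]. *)
- rewrite -oppr_le0 -dotNr; apply: lim => del del0.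
  apply: filterS (eM _ del0) => n; rewrite add0r; apply: le_trans.
  have := step n b Kb; rewrite subrr dot0r pmulr_rge0// dotNr => h.
  have : e n * dot (u n) (b - z) <= e n * M.
    by rewrite ler_pM2l// (le_trans (ubz n))// /M; have := dot_ge0 v; lra.
  lra.
Qed.

End Separation.

(** * Normal cones, minimal faces and vertices *)

Section Normal_cone.
Context {R : realType} {d : nat}.
Implicit Types (u v w b x y z p : 'rV[R]_d) (K F : set 'rV[R]_d).

Lemma segment_in_nbhs x w (U : set 'rV[R]_d) : nbhs x U ->
  exists2 t : R, 0 < t & U (x + t *: w) /\ U (x - t *: w).
Proof.
move=> /nbhs_ballP[e /= e0 eU]; pose t := e / (`|w| + 1).
have w0 : 0 < `|w| + 1 by rewrite ltr_wpDl.
have t0 : 0 < t by exact: divr_gt0.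
have tw : t * `|w| < e.
  by rewrite /t mulrAC ltr_pdivrMr// ltr_pM2l// ltrDl.
exists t => //; split; apply: eU; rewrite mx_norm_ball /ball_ /=.
  by rewrite opprD addrA subrr add0r normrN normrZ gtr0_norm.
by rewrite opprB addrCA subrr addr0 normrZ gtr0_norm.
Qed.

Lemma linear_form_nonconstant K u b : convex_body K -> u != 0 ->
  exists2 x, K x & dot u x != dot u b.
Proof.
move=> [_ _ [z Kz]] u0; have [t t0 [Kt _]] := segment_in_nbhs z u K Kz.
have [e|ne] := eqVneq (dot u z) (dot u b); last first.
  by exists z => //; exact: nbhs_singleton Kz.
exists (z + t *: u) => //; rewrite dotDr e dotZr -subr_eq0 addrAC subrr add0r.
by rewrite gt_eqF// mulr_gt0// dot_gt0.
Qed.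

Lemma boundary_in K b : convex_body K -> boundary K b -> K b.
Proof.
move=> [kK _ _] [+ _]; apply: (compact_closed _ kK).
exact: norm_hausdorff.
Qed.

(** Take a family in [P] of maximal rank: a member of [P] outside its row space would raise the
    rank. *)
Lemma row_span (P : set 'rV[R]_d) : exists m (A : 'M[R]_(m, d)),
  (forall i, P (row i A)) /\ forall u, P u -> (u <= A)%MS.
Proof.
pose Q r := `[< exists m (A : 'M[R]_(m, d)), (forall i, P (row i A)) /\ \rank A = r >].
have Q0 : exists r, Q r.
  by exists (\rank (0 : 'M[R]_(0, d))); apply/asboolP; exists 0%N, 0; split=> // -[].
have Qd r : Q r -> (r <= d)%N.
  by move=> /asboolP[m [A [_ <-]]]; exact: rank_leq_col.
case: (ex_maxnP Q0 Qd) => r /asboolP[m [A [PA rA]]] rmax.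
exists m, A; split=> // u Pu; apply/negPn/negP => nuA.
have : Q (\rank (col_mx u A)).
  apply/asboolP; exists (1 + m)%N, (col_mx u A); split=> // i.
  case: (split_ordP i) => j ->.
    by rewrite rowKu (ord1 j) row_id.
  by rewrite rowKd.
move/rmax; rewrite -rA; apply/negP; rewrite -ltnNge.
suff : (A < col_mx u A)%MS by rewrite ltmxErank => /andP[].
rewrite ltmxE -(addsmxE u A) addsmxSr /=.
by rewrite -(addsmxE u A) addsmx_sub negb_and nuA.
Qed.

Lemma mulmx_tr0 m (A : 'M[R]_(m, d)) x :
  (forall i, dot (row i A) x = 0) -> A *m x^T = 0.
Proof.
move=> h; apply/matrixP => i j; rewrite (ord1 j) !mxE -[RHS](h i).
by apply: eq_bigr => k _; rewrite !mxE.
Qed.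

(* A strictly positive combination of normals at [b] exposes only points
   that none of these normals separates from [b]. *)
Lemma positive_combination K b m (A : 'M[R]_(m, d)) (a : 'rV[R]_m) x :
  (forall i, normal_at K b (row i A)) -> (forall i, 0 < a ord0 i) ->
  K x -> dot (a *m A) x <= dot (a *m A) b /\
    (dot (a *m A) b <= dot (a *m A) x -> A *m (x - b)^T = 0).
Proof.
move=> nA a0 Kx.
have aAE y : dot (a *m A) y = \sum_i a ord0 i * dot (row i A) y.
  rewrite dot_mulmx -mulmxA mxE; apply: eq_bigr => i _; congr (_ * _).
  by rewrite mxE; apply: eq_bigr => j _; rewrite !mxE.
have le i : a ord0 i * dot (row i A) x <= a ord0 i * dot (row i A) b.
  by rewrite ler_pM2l//; exact: nA.
split; first by rewrite !aAE; apply: ler_sum => i _; exact: le.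
move=> ge; apply: mulmx_tr0 => i; apply/eqP; rewrite dotDr dotNr subr_eq0.
rewrite eq_le nA//= -(ler_pM2l (a0 i)).
move: ge; rewrite !aAE (bigD1 i)//= [X in _ <= X](bigD1 i)//= => ge.
have : \sum_(j | j != i) a ord0 j * dot (row j A) x <=
       \sum_(j | j != i) a ord0 j * dot (row j A) b.
  by apply: ler_sum => j _; exact: le.
lra.
Qed.

(** The face is exposed by the sum [q] of normals spanning all normals at [b]: on it each of them,
    hence every normal at [b], is constant. *)
Lemma minimal_face K b : convex_body K -> boundary K b -> exists F, face K F /\
  forall u, unit_sphere u -> normal_at K b u -> gauss_image K F u.
Proof.
move=> hK bb; have Kb := boundary_in _ _ hK bb.
have [m [A [nA spanA]]] := row_span (normal_at K b).
pose q : 'rV[R]_d := const_mx 1 *m A.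
have qP x := positive_combination K b m A (const_mx 1) x nA
  (fun i => eq_ind_r (fun t => 0 < t) ltr01 (mxE _ _ _ _)).
have flat x u : K x -> dot q b <= dot q x -> normal_at K b u -> dot u x = dot u b.
  move=> Kx qx /spanA/submxP[D ->]; have [_ /(_ qx) Ax] := qP x Kx.
  apply/eqP; rewrite -subr_eq0 -dotNr -dotDr dot_mulmx -mulmxA Ax mulmx0.
  by rewrite mxE.
(* The ray with direction 0 misses the interior, so [b] has a unit normal; if [q = 0], it would be
   constant on [K]. *)
have q0 : q != 0.
  apply/eqP => q0; have [|u [u1 nu _]] := normal_of_missed_ray K b 0 hK Kb.
    by move=> t _; rewrite scaler0 addr0; case: bb.
  have [x Kx /eqP] := linear_form_nonconstant K u b hK (unit_neq0 _ u1).
  by apply; apply: flat => //; rewrite q0 !dot0l.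
pose H := hyperplane (normalize q) (dot (normalize q) b).
have Hq x : H x -> dot q x = dot q b.
  rewrite /H /hyperplane /= !dotZl => /mulfI; apply.
  by rewrite gt_eqF// invr_gt0 sqrt_dot_gt0.
exists (H `&` boundary K); split.
  exists (normalize q), H; split=> //; split; first exact: unit_normalize.
  exists (dot (normalize q) b); split=> //; last by exists b.
  move=> x Kx /=; rewrite !dotZl ler_pM2l ?invr_gt0 ?sqrt_dot_gt0//.
  by have [] := qP x Kx.
move=> u u1 nu; exists (hyperplane u (dot u b)).
  by split=> //; exists (dot u b); split=> //; exists b.
move=> x [/Hq qx /(boundary_in _ _ hK) Kx]; apply: flat => //.
by rewrite qx.
Qed.

Lemma rat_approx p (e : R) : 0 < e ->
  exists q : 'rV[rat]_d, forall i, `|map_mx ratr q ord0 i - p ord0 i| < e.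
Proof.
move=> e0.
have h i : exists q : rat, `|ratr q - p ord0 i| < e.
  have [|q] := @rat_in_itvoo R (p ord0 i - e) (p ord0 i + e); first by lra.
  by rewrite in_itv /= => qP; exists q; rewrite ltr_distl.
have [f fP] := choice h; exists (\row_i f i) => i.
by rewrite !mxE.
Qed.

(** Each of the countably many [q] admits at most one such [b] in [K]. *)
Definition rational_vertex K b (q : 'rV[rat]_d) :=
  forall x, K x -> dot (map_mx ratr q) b <= dot (map_mx ratr q) x -> x = b.

(** If the normals span, the sum of a spanning family can be perturbed to a rational vector that is
    still a positive combination of it. *)
Lemma vertex_or_flat K b : (exists q, rational_vertex K b q) \/
  exists2 w, w != 0 & forall u, normal_at K b u -> dot u w = 0.
Proof.
have [m [A [nA spanA]]] := row_span (normal_at K b).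
have [/row_fullP[B BA]|nfull] := boolP (row_full A); [left|right].
  (* Coordinate errors below [1 / M] change each coefficient by less than 1, so the coefficients
     stay positive. *)
  pose M := 1 + \sum_j \sum_i `|B i j|.
  have M0 : 0 < M.
    by rewrite ltr_pwDl//; apply: sumr_ge0 => j _; apply: sumr_ge0.
  have [q qP] := rat_approx (const_mx 1 *m A) _ (divr_gt0 ltr01 M0).
  exists q => x Kx; pose del := map_mx ratr q - const_mx 1 *m A.
  pose a : 'rV[R]_m := const_mx 1 + del *m B.
  have -> : map_mx ratr q = a *m A.
    by rewrite mulmxDl -mulmxA BA mulmx1 addrC subrK.
  have a0 j : 0 < a ord0 j.
    rewrite !mxE -(opprK (\sum_i _)) subr_gt0 -sumrN.
    apply: (@le_lt_trans _ _ (\sum_i M^-1 * `|B i j|)).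
      apply: ler_sum => i _; rewrite -mulNr (le_trans (ler_norm _))//.
      rewrite normrM normrN ler_wpM2r//; have := qP i.
      by rewrite div1r !mxE => /ltW.
    rewrite -mulr_sumr mulrC ltr_pdivrMr// mul1r /M (bigD1 j)//=.
    rewrite addrCA ltrDl ltr_pwDl//.
    by apply: sumr_ge0 => j' _; apply: sumr_ge0.
  move=> ge; have [_ /(_ ge) Ax] := positive_combination K b m A a x nA a0 Kx.
  have : B *m A *m (x - b)^T = 0 by rewrite -mulmxA Ax mulmx0.
  rewrite BA mul1mx => /(congr1 trmx); rewrite trmxK trmx0 => /eqP.
  by rewrite subr_eq0 => /eqP.
have : cokermx A != 0 by rewrite cokermx_eq0.
move/matrix0Pn => [i [j ij]].
exists (col j (cokermx A))^T.
  by apply/eqP => /rowP/(_ i); rewrite [LHS]mxE [LHS]mxE [RHS]mxE => /eqP;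
    rewrite (negbTE ij).
move=> u /spanA; rewrite submxE => /eqP uA.
by rewrite dot_mulmx trmxK colE mulmxA uA mul0mx mxE.
Qed.

End Normal_cone.

(** * Avoiding countably many equalities by a reflection *)

Section Generic_reflection.
Context {R : realType} {d : nat}.
Implicit Types (u v w x y z c : 'rV[R]_d).

HB.instance Definition _ := Complete.on 'rV[R]_d.

(* [(dot c (reflection v y) + kappa) * dot v v], which is quadratic in [v] *)
Definition reflect_form (kappa : R) c y v : R :=
  (dot c y + kappa) * dot v v - 2 * dot v y * dot v c.

(** With [a = dot c y], the value at [c + y] is [2 (1 + a) (kappa - 1)], zero only for [a = -1];
    then the value at [c - y] is [4 (1 + kappa)]. *)
Lemma reflect_form_neq0 kappa c y : 0 < kappa < 1 ->
  unit_sphere c -> unit_sphere y -> exists v, reflect_form kappa c y v != 0.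
Proof.
rewrite /unit_sphere /= => /andP[k0 k1] c1 y1.
have [p0|] := eqVneq (reflect_form kappa c y (c + y)) 0; last by exists (c + y).
exists (c - y); apply/eqP => m0.
move: p0 m0; rewrite /reflect_form !dotE (dotC y c) c1 y1.
move: (dot c y) => a p0 m0.
have /eqP : (1 + a) * (kappa - 1) = 0.
  by apply: (mulfI (x := 2)); rewrite ?pnatr_eq0// mulr0 -[RHS]p0; ring.
rewrite mulf_eq0 (lt_eqF (_ : kappa - 1 < 0)) ?subr_lt0// orbF => /eqP a1.
have {a1}aE : a = -1 by lra.
by move: m0; rewrite aE; lra.
Qed.

(** For density, the parallelogram identity shows that the form cannot vanish at all of [v],
    [v + t w], [v - t w] unless it vanishes at [w]. *)
Lemma dense_reflect_form kappa c y : 0 < kappa < 1 ->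
  unit_sphere c -> unit_sphere y ->
  open [set v | reflect_form kappa c y v != 0] /\
  dense [set v | reflect_form kappa c y v != 0].
Proof.
move=> hk c1 y1; split.
  apply: (continuousP (reflect_form kappa c y)).1 [set x : R | x != 0] _.
    have cst (a : 'rV[R]_d) : continuous (fun _ : 'rV[R]_d => a) by exact: cst_continuous.
    have cd a : continuous (fun v => dot v a : R).
      by apply: continuous_dot => [v|]; [exact: cvg_id|exact: cst].
    have cvv : continuous (fun v => dot v v : R).
      by apply: continuous_dot => v; exact: cvg_id.
    have h1 : continuous (fun v => (dot c y + kappa) * dot v v : R).
      by move=> v; exact: (cvgM (cvg_cst (dot c y + kappa)) (cvv v)).
    have h2 : continuous (fun v => 2 * dot v y * dot v c : R).
      by move=> v; exact: (cvgM (cvgM (cvg_cst (2 : R)) (cd y v)) (cd c v)).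
    by move=> v; exact: (cvgB (h1 v) (h2 v)).
  exact: open_neq.
move=> O [v Ov] oO; have [w wQ] := reflect_form_neq0 _ _ _ hk c1 y1.
have [t t0 [Op Om]] := segment_in_nbhs v w O (open_nbhs_nbhs (conj oO Ov)).
have parallelogram : reflect_form kappa c y (v + t *: w) +
  reflect_form kappa c y (v - t *: w) =
  2 * reflect_form kappa c y v + 2 * t ^+ 2 * reflect_form kappa c y w.
  by rewrite /reflect_form !dotE; ring.
have [v0|] := eqVneq (reflect_form kappa c y v) 0; last by exists v.
have [p0|] := eqVneq (reflect_form kappa c y (v + t *: w)) 0; last by exists (v + t *: w).
exists (v - t *: w); split=> //=; move: parallelogram.
rewrite v0 p0 mulr0 !add0r => ->.
by rewrite mulf_neq0// mulf_neq0// ?pnatr_eq0// expf_neq0// gt_eqF.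
Qed.

Lemma generic_reflection (I : countType) (c y : I -> 'rV[R]_d) kappa :
  0 < kappa < 1 -> exists v, forall i, unit_sphere (c i) -> unit_sphere (y i) ->
  dot (c i) (reflection v (y i)) != - kappa.
Proof.
move=> hk.
(* If [n] codes no index, or one whose vectors are not both unit, then [U n] is the whole space. *)
pose U n : set 'rV[R]_d := [set v | forall i, unpickle n = Some i ->
  unit_sphere (c i) -> unit_sphere (y i) -> reflect_form kappa (c i) (y i) v != 0].
have UP n : open (U n) /\ dense (U n).
  have [[i [ni [c1 y1]]]|no] := pselect (exists i, unpickle n = Some i /\
    unit_sphere (c i) /\ unit_sphere (y i)).
    suff -> : U n = [set v | reflect_form kappa (c i) (y i) v != 0].
      exact: dense_reflect_form.
    apply/seteqP; split=> v /= h; first exact: h.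
    by move=> j; rewrite ni => -[<-].
  suff -> : U n = setT.
    by split; [exact: openT|move=> O [v Ov] _; exists v].
  apply/seteqP; split=> // v _ i ni c1 y1.
  by exfalso; apply: no; exists i.
have [|v [_ vU]] := @Baire _ _ _ UP setT _ openT; first by exists 0.
exists v => i c1 y1.
have := vU (pickle i) Logic.I i (pickleK i) c1 y1.
apply: contra_neq => e; rewrite /reflect_form.
have [->|v0] := eqVneq v 0; first by rewrite !dot0l; ring.
move: e; rewrite /reflection !dotE (dotC (c i) v) => e.
rewrite (_ : kappa = - (dot (c i) (y i) - 2 * dot v (y i) / dot v v * dot v (c i))).
  by field; rewrite gt_eqF// dot_gt0.
by rewrite e opprK.
Qed.

End Generic_reflection.

(** * Caps as inner product inequalities *)

Section Spherical_caps.
Context {R : realType} {d : nat}.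

Lemma spherical_ball_dot (c u : 'rV[R]_d) (t : R) : 0 <= t <= pi ->
  unit_sphere c -> spherical_ball c t u -> cos t <= dot u c.
Proof.
move=> tpi c1 [u1 le]; have cu := unit_dot_le1 _ _ c1 u1.
rewrite leNgt dotC; apply/negP => lt; move: le; apply/negP; rewrite -ltNge.
rewrite -ltr_cos ?acosK ?in_itv//=.
by rewrite acos_ge0 ?acos_lepi.
Qed.

End Spherical_caps.

Theorem theorem1p1 (R : realType) (d : nat) (hd : (3 <= d)%N)
    (K : set 'rV[R]_d) (hK : convex_body K)
    (r : R) (hr : 0 < r)
    (hgauss : forall F : set 'rV[R]_d, face K F ->
       exists c : 'rV[R]_d,
         unit_sphere c /\ gauss_image K F `<=` spherical_ball c r)
    (k : nat) (Y : set 'rV[R]_d) (hYS : Y `<=` unit_sphere) (hYk : Y #= `I_k)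
    (rho : R) (hrho : is_covering_radius Y rho)
    (hle : r + rho <= pi / 2) :
  exists n : nat, is_illumination_number K n /\ (n <= k)%N.
Proof.
suff Kk : illuminated_by K k.
  have ex : exists n, `[< illuminated_by K n >] by exists k; apply/asboolP.
  case: (ex_minnP ex) => n /asboolP nP nmin; exists n.
  by split; [split=> // m mP|]; apply: nmin; apply/asboolP.
have [rho0 cover _] := hrho.
have pi0 := pi_gt0 R.
pose s := sin rho; pose kappa := cos rho.
have sk : s ^+ 2 + kappa ^+ 2 = 1 by rewrite addrC cos2Dsin2.
have s0 : 0 < s by apply: sin_gt0_pihalf; apply/andP; split; lra.
have k0 : 0 < kappa by apply: cos_gt0_pihalf; apply/andP; split; lra.
have k1 : kappa < 1.
  rewrite -(@expr_lt1 _ 2)// ?ltW//; have := exprn_gt0 2 s0; lra.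
have sr : s <= cos r.
  have -> : s = cos (pi / 2 - rho) by rewrite /s -cosBpihalf -cosN opprB.
  rewrite leNgt ltr_cos ?in_itv/=; last 2 first.
  - by apply/andP; split; lra.
  - by apply/andP; split; lra.
  by rewrite -leNgt; lra.
have /choice[cen cenP] b : exists c, boundary K b -> unit_sphere c /\
    forall u, unit_sphere u -> normal_at K b u -> s <= dot u c.
  have [bb|nb] := pselect (boundary K b); last by exists 0.
  have [F [fF FP]] := minimal_face K b hK bb.
  have [c [c1 cP]] := hgauss F fF; exists c => _; split=> // u u1 nu.
  apply: (le_trans sr); apply: spherical_ball_dot => //; first by apply/andP; split; lra.
  by apply: cP; exact: FP.
(* The default 0 is harmless: [generic_reflection] is only applied at pairs whose [q] comes from an
   actual boundary vertex. *)
have /choice[vert vertP] q : exists b0, forall b,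
    boundary K b -> rational_vertex K b q -> b0 = b.
  have [[b0 [bb0 qb0]]|no] := pselect (exists b, boundary K b /\ rational_vertex K b q).
    exists b0 => b bb qb.
    have [le|/ltW le] := lerP (dot (map_mx ratr q) b) (dot (map_mx ratr q) b0).
      by apply: qb => //; exact: boundary_in.
    by symmetry; apply: qb0 => //; exact: boundary_in.
  by exists 0 => b bb qb; exfalso; apply: no; exists b.
have /card_set_bijP[f [fY _ fsurj]] : `I_k #= Y by rewrite card_eq_sym.
have [v vP] := generic_reflection ('rV[rat]_d * 'I_k)%type
  (fun i => cen (vert i.1)) (fun i => f i.2) kappa (introT andP (conj k0 k1)).
have y1 (i : 'I_k) : unit_sphere (reflection v (f i)).
  by apply: unit_reflect; apply: hYS; apply: fY; exact: ltn_ord.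
(* By self-adjointness, covering [z] by reflected caps amounts to covering its reflection by the
   original ones. *)
have y_cover z : unit_sphere z -> exists i : 'I_k, kappa <= dot z (reflection v (f i)).
  move=> z1; have [y Yy yz] := cover _ (unit_reflect v z z1).
  have [i ik fi] := fsurj y Yy; exists (Ordinal ik); rewrite -reflect_dot /= fi.
  apply: spherical_ball_dot => //; last exact: hYS.
  by apply/andP; split; lra.
exists (fun i : 'I_k => reflection v (f i)); split=> // b bb.
have [c1 cP] := cenP b bb.
have [|i iP] := direction_below s kappa s0 k0 sk k _ y1 y_cover (cen b)
    [set u | unit_sphere u /\ normal_at K b u] c1 (fun u h => conj h.1 (cP u h.1 h.2)).
  have [[q qb]|[w w0 wP]] := vertex_or_flat K b; [left|right].
    move=> i; rewrite -(vertP q b bb qb).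
    apply: (vP (q, i)); rewrite /= ?(vertP q b bb qb)//.
    by apply: hYS; apply: fY; exact: ltn_ord.
  by exists w => // u [_ /wP].
exists i; apply: contrapT => miss.
have [t t0|u [u1 nu uv]] := normal_of_missed_ray K b (reflection v (f i)) hK
  (boundary_in _ _ hK bb).
  move=> Kt; apply: miss; exists (b + t *: reflection v (f i)); split=> //.
  by exists t.
by move: uv; rewrite leNgt iP.
Qed.
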